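(* There is a constant $c>0$ such that for every $n\ge1$, the number of distinct P-USOs of the $n$-cube is at most $2^{c n^3}$; i.e., the number of $n$-dimensional P-USOs is $2^{O(n^3)}$.
   Context: For $v\in\{0,1\}^n$ and $I\subseteq[n]$, $v\oplus I$ is obtained from $v$ by flipping the coordinates in $I$; $v\oplus i:=v\oplus\{i\}$. The $n$-cube is the graph with vertex set $\{0,1\}^n$ and edges $\{v,v\oplus i\}$. A subcube is the induced subgraph on a vertex set $\{v\oplus I: I\subseteq C\}$ for some vertex $v$ and $C\subseteq[n]$. A unique-sink orientation (USO) is an orientation of the $n$-cube in which every subcube has exactly one sink (vertex of outdegree zero within the subcube). A P-matrix is a square real matrix all of whose principal minors are positive. For $B\subseteq[n]$, $A_B$ is the $n\times n$ matrix whose $i$th column is the $i$th column of $-M$ if $i\in B$ and of $I_n$ otherwise; $B(v)=\{j: v_j=1\}$. For a P-matrix $M$ and $q\in\mathbb{R}^n$, the pair $(M,q)$ is nondegenerate if $(A_B^{-1}q)_i\ne0$ for all $B\subseteq[n]$, $i\in[n]$; then the orientation induced by $\mathrm{LCP}(M,q)$ is defined by $v\to v\oplus i$ iff $(A_{B(v)}^{-1}q)_i<0$, and it is a USO. A P-USO is a USO induced in this way by some nondegenerate $(M,q)$ with $M$ a P-matrix. *)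

(* Defs.v *)
From HB Require Import structures.
From mathcomp Require Import all_boot all_order all_algebra.
Set Implicit Arguments. Unset Strict Implicit. Unset Printing Implicit Defensive.
Import Order.TTheory GRing.Theory Num.Theory.
Local Open Scope ring_scope.

Definition cube (n : nat) := {ffun 'I_n -> bool}.

Definition vflip n (v : cube n) (I : {set 'I_n}) : cube n :=
  [ffun j => v j (+) (j \in I)].

Definition Bset n (v : cube n) : {set 'I_n} := [set j | v j].

(* An orientation of the n-cube is encoded by o (v,i) = true iff v -> v (+) i. *)
Definition orientation (n : nat) := {ffun (cube n * 'I_n) -> bool}.

Definition is_orientation n (o : orientation n) : Prop :=
  forall v i, o (v, i) = ~~ o (vflip v [set i], i).

Definition subcube n (v : cube n) (C : {set 'I_n}) : {set cube n} :=
  [set vflip v I | I in powerset C].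

Definition subcube_sinks n (o : orientation n) (v : cube n) (C : {set 'I_n})
  : {set cube n} :=
  [set w in subcube v C | [forall i in C, ~~ o (w, i)]].

Definition is_USO n (o : orientation n) : Prop :=
  is_orientation o /\
  forall (v : cube n) (C : {set 'I_n}), #|subcube_sinks o v C| = 1%N.

Definition principal_minor (R : comNzRingType) n (M : 'M[R]_n) (S : {set 'I_n}) : R :=
  \det (\matrix_(i < #|S|, j < #|S|) M (enum_val i) (enum_val j)).

Definition is_Pmatrix (R : realFieldType) n (M : 'M[R]_n) : Prop :=
  forall S : {set 'I_n}, 0 < principal_minor M S.

Definition A_B (R : comNzRingType) n (M : 'M[R]_n) (B : {set 'I_n}) : 'M[R]_n :=
  \matrix_(i, j) (if j \in B then - M i j else (i == j)%:R).

Definition lcp_nondegenerate (R : realFieldType) n (M : 'M[R]_n) (q : 'cV[R]_n)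
  : Prop :=
  forall (B : {set 'I_n}) (i : 'I_n), (invmx (A_B M B) *m q) i 0 != 0.

Definition lcp_induces (R : realFieldType) n (M : 'M[R]_n) (q : 'cV[R]_n)
  (o : orientation n) : Prop :=
  forall (v : cube n) (i : 'I_n),
    o (v, i) = ((invmx (A_B M (Bset v)) *m q) i 0 < 0).

Definition is_PUSO (R : realFieldType) n (o : orientation n) : Prop :=
  is_USO o /\
  exists (M : 'M[R]_n) (q : 'cV[R]_n),
    [/\ is_Pmatrix M, lcp_nondegenerate M q & lcp_induces M q o].

(* Main.v *)
(** The orientation induced by LCP(M, q) is read off the signs of the n 2^n
    polynomials det A_B * (adj A_B q)_i, of degree at most 2n in the n^2 + n
    entries of M and q, so it suffices to have a Warren-type bound on the number
    of nowhere-zero sign patterns of polynomials f_j in k variables.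

    Let F = prod_j f_j have degree at most D.  For small eps > 0 the polynomial
    F^2 - eps * sum_i X_i^(2D+2) is positive at a sample point of each pattern,
    hence attains its maximum over the closure of each sign region in the
    interior.  The critical points solve X_i^(2D+1) = g_i with deg g_i < 2D+1,
    and such a system has at most (2D+1)^k solutions, since the monomials with
    all exponents below 2D+1 span the functions on its solution set.

    Over an arbitrary real closed field the extreme value theorem for polynomials
    comes from quantifier elimination: definable subsets of the line have no
    gaps. *)
Require Import Defs.
From HB Require Import structures.
From mathcomp Require Import all_boot all_order all_algebra.
From Stdlib Require Import Classical.
From mathcomp Require Import mpoly polyrcf ordered_qelim qe_rcf zify ring lra.
Import Order.TTheory GRing.Theory Num.Theory.

Set Implicit Arguments.
Unset Strict Implicit.
Unset Printing Implicit Defensive.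

Local Open Scope ring_scope.

(** * Definable subsets of the line over a real closed field *)

Section DefinableCut.

Variable R : rcfType.
Implicit Types (P Q : R -> bool) (p : {poly R}) (s : seq R).

Definition constant_off s P :=
  forall x y, x <= y -> (forall r, r \in s -> ~~ (x <= r <= y)) -> P x = P y.

(** Equivalently, [P] is a finite union of points and intervals, which is what o-minimality predicts
    for definable sets. *)
Definition piecewise_constant P := exists s, constant_off s P.

Lemma piecewise_constant_cat (op : bool -> bool -> bool) P Q :
  piecewise_constant P -> piecewise_constant Q ->
  piecewise_constant (fun x => op (P x) (Q x)).
Proof.
move=> [s hs] [t ht]; exists (s ++ t) => x y xy off.
rewrite (hs _ _ xy) ?(ht _ _ xy) // => r rs; apply: off.
  by rewrite mem_cat rs orbT.
by rewrite mem_cat rs.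
Qed.

Lemma sgr_poly_off_roots p (x y : R) : x <= y ->
  (forall r, x <= r <= y -> ~~ root p r) -> Num.sg p.[x] = Num.sg p.[y].
Proof.
move=> xy nr.
have nz z : x <= z <= y -> p.[z] != 0 by move/nr; rewrite rootE.
have nx : p.[x] != 0 by apply: nz; rewrite lexx xy.
have ny : p.[y] != 0 by apply: nz; rewrite lexx xy.
have [neg|] := ltP (p.[x] * p.[y]) 0.
  have [z] := poly_ivtoo xy neg; rewrite in_itv /= => /andP[xz zy].
  by apply: contraTeq => _; apply: nr; rewrite !ltW.
rewrite le_eqVlt eq_sym mulf_eq0 (negPf nx) (negPf ny) /= => pos.
move: nx pos; rewrite neq_lt => /orP[x0|x0].
  by rewrite nmulr_rgt0 // => y0; rewrite !ltr0_sg.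
by rewrite pmulr_rgt0 // => y0; rewrite !gtr0_sg.
Qed.

Lemma piecewise_constant_sgr p (b : R -> bool) :
  piecewise_constant (fun x => b (Num.sg p.[x])).
Proof.
have [->|p0] := eqVneq p 0; first by exists [::] => x y _ _; rewrite !horner0.
exists (rootsR p) => x y xy off; rewrite (@sgr_poly_off_roots p x y) // => r rxy.
apply/negP => rr; have /= := roots_on_rootsR p0 => /(_ r).
by rewrite in_itv /= rr => /esym /off; rewrite rxy.
Qed.

(** [GRing.rterm] excludes inverses, so a term is polynomial in variable [i] once the others are
    frozen at their values in [e]. *)
Lemma eval_as_poly (e : seq R) i (t : GRing.term R) : GRing.rterm t ->
  exists p, forall u, GRing.eval (set_nth 0 e i u) t = p.[u].
Proof.
elim: t => //=.
- move=> j _; have [ji|ji] := eqVneq j i.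
    by exists 'X => u; rewrite hornerX nth_set_nth /= ji eqxx.
  by exists (e`_j)%:P => u; rewrite hornerC nth_set_nth /= (negPf ji).
- by move=> x _; exists x%:P => u; rewrite hornerC.
- by move=> n _; exists n%:R%:P => u; rewrite hornerC.
- move=> t IHt v IHv /andP[/IHt[p hp] /IHv[q hq]].
  by exists (p + q) => u; rewrite hornerD hp hq.
- by move=> t IHt /IHt[p hp]; exists (- p) => u; rewrite hornerN hp.
- by move=> t IHt n /IHt[p hp]; exists (p *+ n) => u; rewrite hornerMn hp.
- move=> t IHt v IHv /andP[/IHt[p hp] /IHv[q hq]].
  by exists (p * q) => u; rewrite hornerM hp hq.
- by move=> t IHt n /IHt[p hp]; exists (p ^+ n) => u; rewrite horner_exp hp.
Qed.

Lemma piecewise_constant_ext P Q :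
  P =1 Q -> piecewise_constant P -> piecewise_constant Q.
Proof. by move=> PQ [s hs]; exists s => x y xy off; rewrite -!PQ (hs x y). Qed.

Lemma piecewise_constant_qf (e : seq R) i (f : ord.formula R) :
  ord.qf_form f -> ord.rformula f ->
  piecewise_constant (fun u => ord.qf_eval (set_nth 0 e i u) f).
Proof.
(* Equality and both inequalities between [t] and [v] are conditions on the sign of their
   difference. *)
have atom (b : R -> bool) t v : GRing.rterm t && GRing.rterm v ->
    piecewise_constant (fun u => b (Num.sg (GRing.eval (set_nth 0 e i u) t -
                                            GRing.eval (set_nth 0 e i u) v))).
  move=> /andP[/(eval_as_poly e i)[p hp] /(eval_as_poly e i)[q hq]].
  have := piecewise_constant_sgr (p - q) b; apply: piecewise_constant_ext => u.
  by rewrite hp hq hornerD hornerN.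
elim: f => //=.
- by move=> b _ _; exists [::].
- move=> t v _ /(atom (fun x => x == 0)); apply: piecewise_constant_ext => u.
  by rewrite sgr_eq0 subr_eq0.
- move=> t v _ /(atom (fun x => x < 0)); apply: piecewise_constant_ext => u.
  by rewrite sgr_lt0 subr_lt0.
- move=> t v _ /(atom (fun x => x <= 0)); apply: piecewise_constant_ext => u.
  by rewrite sgr_le0 subr_le0.
- move=> f IHf g IHg /andP[? ?] /andP[? ?].
  by apply: (piecewise_constant_cat andb); [apply: IHf|apply: IHg].
- move=> f IHf g IHg /andP[? ?] /andP[? ?].
  by apply: (piecewise_constant_cat orb); [apply: IHf|apply: IHg].
- move=> f IHf g IHg /andP[? ?] /andP[? ?].
  by apply: (piecewise_constant_cat implb); [apply: IHf|apply: IHg].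
- move=> f IHf qf rf; have [s hs] := IHf qf rf.
  by exists s => x y xy off; rewrite (hs x y).
Qed.

(** [rcf_sat] evaluates the output of quantifier elimination, so the quantifier-free case applies
    directly. *)
Lemma piecewise_constant_sat (e : seq R) i (f : ord.formula R) :
  piecewise_constant (fun u => rcf_sat (set_nth 0 e i u) f).
Proof.
have /andP[qf rf] := ord.quantifier_elim_wf (@wf_QE_wproj R)
  (ord.to_rform_rformula f).
exact: piecewise_constant_qf.
Qed.

(** Induction on the breakpoints, shrinking ]a, b[ around the cut until none is left inside. *)
Lemma piecewise_constant_cut P a b :
  piecewise_constant P -> a <= b -> P a -> ~~ P b ->
  (forall x y, x <= y -> P y -> P x) ->
  exists c, (forall x, x < c -> P x) /\ (forall x, c < x -> ~~ P x).
Proof.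
move=> [s hs] ab Pa Pb mono.
have {hs}: forall x y, a < x -> x <= y -> y < b ->
   (forall r, r \in s -> ~~ (x <= r <= y)) -> P x = P y.
  by move=> x y _ xy _; apply: hs.
elim: s a b ab Pa Pb => [|r s IHs] a b ab Pa Pb hs.
  have below x : x <= a -> P x by move=> xa; apply: mono Pa.
  have above x : b <= x -> ~~ P x by move=> bx; apply: contra Pb; apply: mono.
  (* [P] is constant on ]a, b[; its value at the midpoint tells at which end the cut lies. *)
  have [Pm|nPm] := boolP (P ((a + b) / 2)).
    exists b; split=> x bx; last by apply: above; apply: ltW.
    have [/below//|ax] := leP x a.
    have [xm|mx] := leP x ((a + b) / 2); first exact: mono Pm.
    rewrite -(hs ((a + b) / 2) x) //; [lra | exact: ltW].
  exists a; split=> x ax; first by apply: below; apply: ltW.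
  have [/above//|xb] := leP b x.
  have [xm|mx] := leP x ((a + b) / 2); first by rewrite (hs _ _ ax xm) //; lra.
  by apply: contra nPm; apply: mono; apply: ltW.
have [/andP[ar rb]|nr] := boolP (a < r < b); last first.
  apply: (IHs a b) => // x y ax xy yb off; apply: hs => // r'.
  rewrite inE => /orP[/eqP->|/off//]; apply: contra nr => /andP[xr ry].
  by rewrite (lt_le_trans ax xr) (le_lt_trans ry yb).
(* The value at [r] tells which half to keep; [r] becomes an end of it. *)
have [Pr|nPr] := boolP (P r).
  apply: (IHs r b) => //; first exact: ltW.
  move=> x y rx xy yb off; apply: hs => //; first exact: lt_trans rx.
  by move=> r'; rewrite inE => /orP[/eqP->|/off//]; rewrite leNgt rx.
apply: (IHs a r) => //; first exact: ltW.
move=> x y ax xy yr off; apply: hs => //; first exact: lt_trans rb.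
by move=> r'; rewrite inE => /orP[/eqP->|/off//]; rewrite (leNgt r) yr andbF.
Qed.

(** Stands in for completeness: a definable lower set, neither empty nor everything, has a
    supremum. *)
Lemma definable_cut (e : seq R) i (f : ord.formula R) (P : R -> Prop) a b :
  (forall u, ord.holds (set_nth 0 e i u) f <-> P u) ->
  P a -> ~ P b -> (forall x y, x <= y -> P y -> P x) ->
  exists c, (forall x, x < c -> P x) /\ (forall x, c < x -> ~ P x).
Proof.
move=> fP Pa Pb mono.
have satP u : reflect (P u) (rcf_sat (set_nth 0 e i u) f).
  by apply: (equivP (rcf_satP _ _)).
have ab : a <= b by rewrite leNgt; apply/negP => /ltW/mono/(_ Pa).
have [|c [lo hi]] := piecewise_constant_cut (piecewise_constant_sat e i f) ab
  (introT (satP a) Pa) (introN (satP b) Pb).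
  by move=> x y xy /satP Py; apply/satP; apply: mono Py.
by exists c; split=> x xc; [apply/satP; apply: lo|apply/satP; apply: hi].
Qed.

End DefinableCut.

(** * Continuity, growth and partial derivatives of multivariate polynomials *)

Section MpolyAnalysis.

Variables (R : rcfType) (k : nat).
Implicit Types (p q : {mpoly R[k]}) (x a : {ffun 'I_k -> R}).

Lemma mpoly_ring_ind (P : {mpoly R[k]} -> Prop) :
  (forall c, P c%:MP) -> (forall i, P 'X_i) ->
  (forall p q, P p -> P q -> P (p + q)) ->
  (forall p q, P p -> P q -> P (p * q)) -> forall p, P p.
Proof.
move=> PC PX PD PM; elim/mpolyind => [|c m p _ _ Pp]; first by rewrite -mpolyC0.
apply: (PD) => //; rewrite -mul_mpolyC; apply: (PM) => //.
rewrite mpolyXE_id; apply: (big_ind P) => [|//|i _]; first by rewrite -mpolyC1.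
by elim: (m i) => [|n IHn]; rewrite ?expr0 -?mpolyC1 // exprS; apply: (PM).
Qed.

Lemma meval_continuous p a (e : R) : 0 < e ->
  exists2 d, 0 < d &
    forall x, (forall i, `|x i - a i| <= d) -> `|p.@[x] - p.@[a]| < e.
Proof.
elim/mpoly_ring_ind: p e => [c|i|p q IHp IHq|p q IHp IHq] e e0.
- by exists 1 => // x _; rewrite !mevalC subrr normr0.
- exists (e / 2) => [|x xa]; first by lra.
  by rewrite !mevalXU; apply: le_lt_trans (xa i) _; lra.
- have [|d1 d10 h1] := IHp (e / 2); first by lra.
  have [|d2 d20 h2] := IHq (e / 2); first by lra.
  exists (Num.min d1 d2) => [|x xa]; first by rewrite lt_min d10.
  have {}h1 : `|p.@[x] - p.@[a]| < e / 2.
    by apply: h1 => i; apply: le_trans (xa i) _; rewrite ge_min lexx.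
  have {}h2 : `|q.@[x] - q.@[a]| < e / 2.
    by apply: h2 => i; apply: le_trans (xa i) _; rewrite ge_min lexx orbT.
  rewrite !mevalD opprD addrACA; apply: le_lt_trans (ler_normD _ _) _; lra.
- set A := `|p.@[a]|; set B := `|q.@[a]|.
  have A0 : 0 <= A by apply: normr_ge0.
  have B0 : 0 <= B by apply: normr_ge0.
  have [|d1 d10 h1] := IHp (e / (2 * (B + 1))).
    by apply: divr_gt0 => //; lra.
  (* The minimum with 1 keeps [|q(x)|] at most [B + 1]. *)
  have [|d2 d20 h2] := IHq (Num.min 1 (e / (2 * (A + 1)))).
    by rewrite lt_min ltr01 divr_gt0 //; lra.
  exists (Num.min d1 d2) => [|x xa]; first by rewrite lt_min d10.
  have {}h1 : `|p.@[x] - p.@[a]| < e / (2 * (B + 1)).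
    by apply: h1 => i; apply: le_trans (xa i) _; rewrite ge_min lexx.
  have : `|q.@[x] - q.@[a]| < Num.min 1 (e / (2 * (A + 1))).
    by apply: h2 => i; apply: le_trans (xa i) _; rewrite ge_min lexx orbT.
  rewrite lt_min => /andP[q1 {}h2].
  have qx : `|q.@[x]| <= B + 1.
    rewrite -(subrK q.@[a] q.@[x]); apply: le_trans (ler_normD _ _) _.
    by rewrite addrC lerD2l ltW.
  rewrite !mevalM.
  have -> : p.@[x] * q.@[x] - p.@[a] * q.@[a] =
     (p.@[x] - p.@[a]) * q.@[x] + p.@[a] * (q.@[x] - q.@[a]) by ring.
  apply: le_lt_trans (ler_normD _ _) _; rewrite !normrM -/A.
  have le1 : `|p.@[x] - p.@[a]| * `|q.@[x]| <= e / 2.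
    have -> : e / 2 = e / (2 * (B + 1)) * (B + 1) by field; lra.
    by apply: ler_pM => //; apply: ltW.
  have lt2 : A * `|q.@[x] - q.@[a]| < e / 2.
    have -> : e / 2 = (A + 1) * (e / (2 * (A + 1))) by field; lra.
    apply: le_lt_trans (_ : _ <= (A + 1) * `|q.@[x] - q.@[a]|) _.
      by apply: ler_wpM2r => //; lra.
    by rewrite ltr_pM2l //; lra.
  lra.
Qed.

Lemma meval_growth p d : (msize p <= d.+1)%N ->
  exists2 C : R, 0 <= C &
    forall x (N : R), 1 <= N -> (forall i, `|x i| <= N) ->
      `|p.@[x]| <= C * N ^+ d.
Proof.
move=> pd; exists (\sum_(m <- msupp p) `|p@_m|).
  by apply: sumr_ge0 => m _; apply: normr_ge0.
move=> x N N1 xN; rewrite mevalE mulr_suml.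
apply: le_trans (ler_norm_sum _ _ _) _.
rewrite big_seq [leRHS]big_seq; apply: ler_sum => m mp.
rewrite normrM ler_wpM2l // normr_prod.
have md : (mdeg m <= d)%N by rewrite -ltnS (leq_trans (msize_mdeg_lt mp)).
apply: le_trans (_ : _ <= N ^+ mdeg m) _; last by apply: ler_weXn2l.
rewrite mdegE -prodrXr; apply: ler_prod => i _.
by rewrite normr_ge0 normrX lerXn2r // nnegrE // (le_trans _ N1).
Qed.

(** Restriction of [p] to the line through [a] along axis [i], parametrised by the displacement from
    [a]; it reduces partial derivatives to univariate ones. *)
Definition line_poly a (i : 'I_k) p : {poly R} :=
  mmap polyC (fun j => (a j)%:P + (j == i)%:R *: 'X) p.

Lemma horner_line_poly a i p t :
  (line_poly a i p).[t] = p.@[[ffun j => a j + (j == i)%:R * t]].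
Proof.
rewrite /line_poly; elim/mpoly_ring_ind: p => [c|j|p q IHp IHq|p q IHp IHq].
- by rewrite mmapC mevalC hornerC.
- by rewrite mmapX mmap1U mevalXU ffunE hornerD hornerC hornerZ hornerX.
- by rewrite mmapD mevalD hornerD IHp IHq.
- by rewrite rmorphM mevalM hornerM IHp IHq.
Qed.

Lemma deriv_line_poly a i p : ((line_poly a i p)^`()).[0] = (p^`M(i)).@[a].
Proof.
have at0 q : (line_poly a i q).[0] = q.@[a].
  by rewrite horner_line_poly; apply: meval_eq => j; rewrite ffunE mulr0 addr0.
elim/mpoly_ring_ind: p => [c|j|p q IHp IHq|p q IHp IHq].
- by rewrite /line_poly mmapC mderivC derivC horner0 meval0.
- rewrite /line_poly mmapX mmap1U derivD derivC add0r derivZ derivX.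
  rewrite hornerZ hornerC mulr1 mderivX mevalZ mnm1E.
  have [->|_] := eqVneq j i; last by rewrite !mul0r.
  by rewrite mevalX big1 ?mulr1 // => l _; rewrite mnmBE subnn.
- by rewrite /line_poly !rmorphD /= derivD hornerD mderivD mevalD -IHp -IHq.
- rewrite {1}/line_poly rmorphM /= derivM -!/(line_poly _ _ _).
  by rewrite hornerD !hornerM !at0 mderivM mevalD !mevalM -IHp -IHq.
Qed.

Lemma eval_mpoly_term p :
  exists t : GRing.term R, forall e : seq R,
    GRing.eval e t = p.@[[ffun i : 'I_k => e`_i]].
Proof.
elim/mpoly_ring_ind: p => [c|i|p q [t ht] [v hv]|p q [t ht] [v hv]].
- by exists (GRing.Const c) => e; rewrite mevalC.
- by exists (GRing.Var _ i) => e; rewrite mevalXU ffunE.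
- by exists (GRing.Add t v) => e; rewrite mevalD /= ht hv.
- by exists (GRing.Mul t v) => e; rewrite mevalM /= ht hv.
Qed.

End MpolyAnalysis.

(** Otherwise the derivative keeps the sign of [D] near 0, and the mean value theorem gives a larger
    value at [h] or at [- h]. *)
Lemma deriv_local_max (R : rcfType) (p : {poly R}) (d : R) : 0 < d ->
  (forall t, `|t| < d -> p.[t] <= p.[0]) -> p^`().[0] = 0.
Proof.
move=> d0 pmax; set D := p^`().[0].
have [//|D0] := eqVneq D 0.
have [e e0 De] : exists2 e, 0 < e & forall y, `|y - 0| < e ->
    `|p^`().[y] - D| < `|D|.
  by apply: poly_cont; rewrite normr_gt0.
set h := Num.min d e / 2.
have m0 : 0 < Num.min d e by rewrite lt_min d0.
have h0 : 0 < h by rewrite /h; lra.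
have hd : h < d by apply: lt_le_trans (_ : Num.min d e <= d);
  [rewrite /h; lra | rewrite ge_min lexx].
have he : h < e by apply: lt_le_trans (_ : Num.min d e <= e);
  [rewrite /h; lra | rewrite ge_min lexx orbT].
have [Dp|Dn] := ltrP 0 D.
  have [c ch] := poly_mvt p h0; rewrite in_itv /= in ch.
  have := pmax h; rewrite gtr0_norm // => /(_ hd).
  have := De c; rewrite subr0 gtr0_norm ?(andP ch).1 // => /(_ _)/= H pe.
  have {}H : `|p^`().[c] - D| < `|D|.
    by apply: H; case/andP: ch => _ /lt_trans; apply.
  move: H; rewrite (gtr0_norm Dp) ltr_norml => /andP[lo _].
  by nra.
have {D0}Dn : D < 0 by rewrite lt_neqAle D0.
have mh : - h < 0 by lra.
have [c ch] := poly_mvt p mh; rewrite in_itv /= in ch.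
have := pmax (- h); rewrite normrN gtr0_norm // => /(_ hd) ph pe.
have H : `|p^`().[c] - D| < `|D|.
  apply: De; case/andP: ch => c1 c2; rewrite subr0 ltr_norml; apply/andP; split; lra.
move: H; rewrite (ltr0_norm Dn) ltr_norml => /andP[_ hi].
by nra.
Qed.

(** * The extreme value theorem over a real closed field *)

Section ExtremeValue.

Variable R : rcfType.

Definition definable (P : seq R -> Prop) :=
  exists f : ord.formula R, forall e, ord.holds e f <-> P e.

Definition term_definable (phi : seq R -> R) :=
  exists t : GRing.term R, forall e, GRing.eval e t = phi e.

Lemma definable_ext (P Q : seq R -> Prop) :
  (forall e, P e <-> Q e) -> definable P -> definable Q.
Proof. by move=> PQ [f hf]; exists f => e; rewrite hf. Qed.

Lemma definable_and (P Q : seq R -> Prop) :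
  definable P -> definable Q -> definable (fun e => P e /\ Q e).
Proof.
by move=> [f hf] [g hg]; exists (ord.And f g) => e /=; rewrite hf hg.
Qed.

Lemma definable_impl (P Q : seq R -> Prop) :
  definable P -> definable Q -> definable (fun e => P e -> Q e).
Proof.
by move=> [f hf] [g hg]; exists (ord.Implies f g) => e /=; rewrite hf hg.
Qed.

Lemma definable_le (phi psi : seq R -> R) :
  term_definable phi -> term_definable psi ->
  definable (fun e => phi e <= psi e).
Proof. by move=> [t ht] [v hv]; exists (ord.Le t v) => e /=; rewrite ht hv. Qed.

Lemma definable_lt (phi psi : seq R -> R) :
  term_definable phi -> term_definable psi ->
  definable (fun e => phi e < psi e).
Proof. by move=> [t ht] [v hv]; exists (ord.Lt t v) => e /=; rewrite ht hv. Qed.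

Lemma definable_all_in (T : eqType) (s : seq T) (P : T -> seq R -> Prop) :
  (forall g, definable (P g)) -> definable (fun e => forall g, g \in s -> P g e).
Proof.
move=> dP; elim: s => [|g s [f hf]]; first by exists (ord.Bool true).
have [h hh] := dP g; exists (ord.And h f) => e /=; rewrite hf hh.
split=> [[Pg Ps] g'|Ps]; first by rewrite inE => /orP[/eqP->|/Ps].
by split=> [|g' g's]; apply: Ps; rewrite inE ?eqxx // g's orbT.
Qed.

Lemma definable_forall i (P : seq R -> Prop) :
  definable P -> definable (fun e => forall v, P (set_nth 0 e i v)).
Proof.
move=> [f hf]; exists (ord.Forall i f) => e /=.
by split=> H v; apply/hf; apply: H.
Qed.

(** Quantifies over a whole point, stored in the first [m] entries of the environment. Each
    induction step absorbs the last variable of the block into the formula. *)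
Lemma definable_exists_prefix m (P : seq R -> Prop) :
  definable P -> definable (fun e => exists s, size s = m /\ P (s ++ drop m e)).
Proof.
move=> [f hf].
suff [g hg]: definable (fun e => exists s, size s = m /\ ord.holds (s ++ drop m e) f).
  by exists g => e; rewrite hg; split=> -[s [sm]] /hf ?; exists s.
elim: m f {P hf} => [|m IHm] f.
  exists f => e; rewrite drop0; split=> [fe|[s [/size0nil-> //]]].
  by exists [::].
have [g hg] := IHm (ord.Exists m f); exists g => e; rewrite hg.
have same s v : size s = m ->
    GRing.same_env (set_nth 0 (s ++ drop m e) m v) (rcons s v ++ drop m.+1 e).
  move=> sm j; rewrite nth_set_nth /= cat_rcons !nth_cat sm.
  have [->|jm] := eqVneq j m; first by rewrite ltnn subnn.
  case: ltnP => // mj; have -> : (j - m = (j - m.+1).+1)%N by lia.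
  by rewrite /= !nth_drop; congr (_`_ _); lia.
split=> [[s [sm /= [v]]]|[s]].
  move/(ord.eq_holds (same s v sm)) => fs.
  by exists (rcons s v); rewrite size_rcons sm.
case/lastP: s => [[]//|s v]; rewrite size_rcons => -[[sm]].
move/(ord.eq_holds (GRing.same_env_sym (same s v sm))) => fs.
by exists s; split=> //=; exists v.
Qed.

Variable k : nat.
Implicit Types (x a : {ffun 'I_k -> R}) (Hs s gs : seq {mpoly R[k]}).
Implicit Types (lim : {mpoly R[k]} -> R).

Definition env_point (e : seq R) : {ffun 'I_k -> R} := [ffun i : 'I_k => e`_i].

Lemma env_point_cat x e : env_point (codom x ++ e) = x.
Proof.
apply/ffunP => i; rewrite ffunE nth_cat size_codom card_ord ltn_ord.
by rewrite codomE (nth_map i) ?size_enum_ord // nth_ord_enum.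
Qed.

Definition nonneg_locus Hs x := forall h, h \in Hs -> 0 <= h.@[x].

Definition close_to s lim (d : R) x :=
  forall g, g \in s -> `|g.@[x] - lim g| <= d.

(** The values [lim] on [s] lie in the closure of the image of the locus under [s]. This replaces
    convergent subsequences, which a general real closed field does not provide. *)
Definition adherent Hs s lim :=
  forall d : R, 0 < d -> exists x, nonneg_locus Hs x /\ close_to s lim d x.

Lemma term_definable_mpoly (p : {mpoly R[k]}) :
  term_definable (fun e => p.@[env_point e]).
Proof. exact: eval_mpoly_term. Qed.

Lemma term_definable_var i : term_definable (fun e => e`_i).
Proof. by exists (GRing.Var _ i). Qed.

(** Layout of the environment: entries below [k] hold the point, entry [k] the tolerance [d], entry
    [k.+1] the threshold for [g]. *)
Lemma definable_limsup Hs s lim (g : {mpoly R[k]}) :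
  definable (fun e => forall d : R, 0 < d ->
     exists x, [/\ nonneg_locus Hs x, close_to s lim d x & e`_k.+1 <= g.@[x]]).
Proof.
have dist_definable h : definable (fun e => `|h.@[env_point e] - lim h| <= e`_k).
  have [t ht] := term_definable_mpoly h.
  exists (ord.And (ord.Le (GRing.Add t (GRing.Const (- lim h))) (GRing.Var _ k))
                  (ord.Le (GRing.Opp (GRing.Add t (GRing.Const (- lim h))))
                          (GRing.Var _ k))) => e /=.
  rewrite ht ler_norml lerNl; split=> [[-> ->]//|/andP[-> ->]//].
have dQ : definable (fun e => (nonneg_locus Hs (env_point e) /\
    (forall h, h \in s -> `|h.@[env_point e] - lim h| <= e`_k)) /\
    e`_k.+1 <= g.@[env_point e]).
  apply: definable_and; last first.
    exact: definable_le (term_definable_var _) (term_definable_mpoly _).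
  apply: definable_and; apply: definable_all_in => // h.
  apply: (@definable_le (fun=> 0)); last exact: term_definable_mpoly.
  by exists (GRing.Const 0).
have zero : term_definable (fun=> 0) by exists (GRing.Const 0).
have := definable_forall k (definable_impl
  (definable_lt zero (term_definable_var k)) (definable_exists_prefix k dQ)).
have nth_k t e d : size t = k -> (t ++ drop k (set_nth 0 e k d))`_k = d.
  by move=> tk; rewrite nth_cat tk ltnn subnn nth_drop addn0 nth_set_nth /= eqxx.
have nth_k1 t e d : size t = k -> (t ++ drop k (set_nth 0 e k d))`_k.+1 = e`_k.+1.
  move=> tk; rewrite nth_cat tk ltnNge leqnSn /= subSnn nth_drop addn1.
  by rewrite nth_set_nth /= gtn_eqF.
apply: definable_ext => e; split=> H d; last first.
  rewrite nth_set_nth /= eqxx => /H[x [Hx sx gx]].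
  have xk : size (codom x) = k by rewrite size_codom card_ord.
  by exists (codom x); rewrite nth_k // nth_k1 // env_point_cat.
move=> d0; case: (H d) => [|t [tk]]; first by rewrite nth_set_nth /= eqxx.
rewrite nth_k // nth_k1 // => -[[Hx sx] gx].
by exists (env_point (t ++ drop k (set_nth 0 e k d))).
Qed.

(* The value c is the limit superior of g over the locus as the polynomials of s
   approach their prescribed limits. *)
Lemma adherent_cons Hs s lim (g : {mpoly R[k]}) (B : R) :
  adherent Hs s lim -> (forall x, nonneg_locus Hs x -> `|g.@[x]| <= B) ->
  exists c : R,
    (forall d : R, 0 < d -> exists x,
        [/\ nonneg_locus Hs x, close_to s lim d x & `|g.@[x] - c| <= d]) /\
    (forall u, c < u -> exists2 d : R, 0 < d &
        forall x, nonneg_locus Hs x -> close_to s lim d x -> g.@[x] < u).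
Proof.
move=> adh gB; have [f hf] := definable_limsup Hs s lim g.
pose U (u : R) := forall d : R, 0 < d ->
  exists x, [/\ nonneg_locus Hs x, close_to s lim d x & u <= g.@[x]].
have fU u : ord.holds (set_nth 0 [::] k.+1 u) f <-> U u.
  by rewrite hf nth_set_nth /= eqxx.
have Ulo : U (- B).
  move=> d /adh[x [Hx sx]]; exists x; split=> //.
  by have := gB x Hx; rewrite ler_norml => /andP[].
have Uhi : ~ U (B + 1).
  move=> /(_ 1 ltr01)[x [Hx _ gx]].
  by have := gB x Hx; rewrite ler_norml => /andP[_]; lra.
have Umono u v : u <= v -> U v -> U u.
  by move=> uv Uv d /Uv[x [Hx sx gx]]; exists x; split=> //; apply: le_trans gx.
have [c [lo hi]] := definable_cut fU Ulo Uhi Umono.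
have above u : c < u -> exists2 d : R, 0 < d &
    forall x, nonneg_locus Hs x -> close_to s lim d x -> g.@[x] < u.
  move=> /hi nU; apply: NNPP => nd; apply: nU => d d0.
  apply: NNPP => nx; apply: nd; exists d => // x Hx sx.
  by rewrite ltNge; apply/negP => gx; apply: nx; exists x.
exists c; split=> // d d0.
have [|d' d'0 gd'] := above (c + d); first by lra.
have cd : c - d < c by lra.
have [|x [Hx sx gx]] := lo _ cd (Num.min d d').
  by rewrite lt_min d0.
have sx' (e : R) : Num.min d d' <= e -> close_to s lim e x.
  by move=> de h /sx /le_trans; apply.
exists x; split=> //; first by apply: sx'; rewrite ge_min lexx.
have : g.@[x] < c + d by apply: gd' => //; apply: sx'; rewrite ge_min lexx orbT.
by move=> gcd; rewrite ler_norml; apply/andP; split; lra.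
Qed.

(** Plays the role of Bolzano-Weierstrass: the bounded polynomials of [gs] receive limits one at a
    time from [adherent_cons], compatibly with those already fixed. *)
Lemma adherent_extend Hs s lim gs (B : R) :
  adherent Hs s lim ->
  (forall g x, g \in gs -> nonneg_locus Hs x -> `|g.@[x]| <= B) ->
  exists lim', {in s, lim' =1 lim} /\ adherent Hs (gs ++ s) lim'.
Proof.
move=> adh; elim: gs => [|g gs IHgs] gB; first by exists lim.
have [|lim1 [lim1E adh1]] := IHgs.
  by move=> h x hgs; apply: gB; rewrite inE hgs orbT.
(* A polynomial that already has a limit must keep it, [lim1] being a function. *)
have [gin|gout] := boolP (g \in gs ++ s).
  exists lim1; split=> // d /adh1[x [Hx sx]]; exists x; split=> // h.
  by rewrite inE => /orP[/eqP->|]; apply: sx.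
have [|c [adhc _]] := adherent_cons adh1 (g := g) (B := B).
  by move=> x; apply: gB; rewrite mem_head.
exists (fun h => if h == g then c else lim1 h); split.
  move=> h hs; case: eqP => [hg|_]; last exact: lim1E.
  by move: gout; rewrite -hg mem_cat hs orbT.
move=> d /adhc[x [Hx sx gx]]; exists x; split=> // h.
by rewrite inE; case: eqP => [->//|_] /sx.
Qed.

(** Let [c] be the supremum of [p] on the locus. With [p] tending to [c], limits are chosen for the
    coordinates; they form the maximiser [a], by continuity of [p] and of the constraints. *)
Theorem mpoly_extreme_value Hs (p : {mpoly R[k]}) (B : R) x0 :
  nonneg_locus Hs x0 ->
  (forall x, nonneg_locus Hs x -> forall i, `|x i| <= B) ->
  exists a, nonneg_locus Hs a /\ forall x, nonneg_locus Hs x -> p.@[x] <= p.@[a].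
Proof.
move=> Hx0 bounded.
have [C C0 growth] := meval_growth (leqnSn (msize p)).
have pB x : nonneg_locus Hs x -> `|p.@[x]| <= C * Num.max 1 B ^+ msize p.
  move=> Hx; apply: growth; first by rewrite le_max lexx.
  by move=> i; rewrite le_max bounded ?orbT.
(* With no prescribed limits, the limit superior is the supremum. *)
have adh0 : adherent Hs [::] (fun=> 0) by move=> d _; exists x0.
have [c [adhc cmax]] := adherent_cons adh0 pB.
have pc x : nonneg_locus Hs x -> p.@[x] <= c.
  move=> Hx; rewrite leNgt; apply/negP => /cmax[d _ px].
  by have : p.@[x] < p.@[x]; [apply: px | rewrite ltxx].
have adhp : adherent Hs [:: p] (fun=> c).
  move=> d /adhc[x [Hx _ px]]; exists x; split=> // h.
  by rewrite inE => /eqP->.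
have [|lim [limE adh]] := adherent_extend (gs := [seq 'X_i | i <- enum 'I_k])
  (B := B) adhp.
  by move=> g x /mapP[i _ ->] Hx; rewrite mevalXU bounded.
pose a : {ffun 'I_k -> R} := [ffun i => lim 'X_i].
have near d : 0 < d -> exists x,
    [/\ nonneg_locus Hs x, forall i, `|x i - a i| <= d & `|p.@[x] - c| <= d].
  move=> /adh[x [Hx sx]]; exists x; split=> // [i|].
    rewrite ffunE -[X in `|X - _|](mevalXU x); apply: sx.
    rewrite mem_cat; apply/orP; left; apply/mapP; exists i => //.
    by rewrite mem_enum.
  by rewrite -(limE p) ?mem_head //; apply: sx; rewrite mem_cat mem_head orbT.
(* Inequalities that hold up to [d] near [a] pass to [a]; used for each constraint with [u = 0] and
   for [p] with [u = c]. *)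
have limit (q : {mpoly R[k]}) (u e : R) : 0 < e ->
    (forall x d, 0 < d -> d <= e -> nonneg_locus Hs x -> `|p.@[x] - c| <= d ->
       u - d <= q.@[x]) ->
    u <= q.@[a].
  move=> e0 qu; rewrite leNgt; apply/negP => qa.
  have [|d d0 qd] := @meval_continuous _ _ q a ((u - q.@[a]) / 2); first by lra.
  pose d' := Num.min d (Num.min e ((u - q.@[a]) / 2)).
  have d'0 : 0 < d' by rewrite !lt_min d0 e0 /=; lra.
  have d'd : d' <= d by rewrite ge_min lexx.
  have d'e : d' <= e by rewrite !ge_min lexx orbT.
  have d'u : d' <= (u - q.@[a]) / 2 by rewrite !ge_min lexx !orbT.
  have [x [Hx xa px]] := near d' d'0.
  have := qu x d' d'0 d'e Hx px.
  have := qd x (fun i => le_trans (xa i) d'd).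
  by rewrite ltr_norml => /andP[_]; lra.
exists a; split=> [h hHs|y /pc/le_trans]; last apply.
  apply: (limit _ _ 1) => // x d d0 _ Hx _; have := Hx h hHs; lra.
apply: (limit _ _ 1) => // x d _ _ _; rewrite ler_norml => /andP[]; lra.
Qed.

End ExtremeValue.

(** * Counting the solutions of a system with pure leading powers *)

(** The rows of [V] are the [e ^ k] monomials with all exponents below [e], evaluated at the [m]
    points. They span all functions on the points, so [m] is the rank of [V]. *)
Lemma card_triangular_solutions (F : fieldType) k e m
    (y : 'I_m -> {ffun 'I_k -> F}) (g : 'I_k -> {mpoly F[k]}) :
  injective y -> (forall i, (msize (g i) <= e)%N) ->
  (forall a i, y a i ^+ e = (g i).@[y a]) -> (m <= e ^ k)%N.
Proof.
move=> y_inj ge yg.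
pose ev (p : {mpoly F[k]}) : 'rV_m := \row_a p.@[y a].
pose V : 'M[F]_(#|{ffun 'I_k -> 'I_e}|, m) :=
  \matrix_(b, a) \prod_i y a i ^+ (enum_val b : {ffun 'I_k -> 'I_e}) i.
have evV N (p : {mpoly F[k]}) : (msize p <= N)%N -> (ev p <= V)%MS.
  elim: N p => [|N IHN] p pN.
    have -> : p = 0 by apply/eqP; rewrite -msize_poly_eq0 -leqn0.
    have -> : ev 0 = 0 by apply/rowP => a; rewrite !mxE meval0.
    exact: sub0mx.
  have -> : ev p = \sum_(u <- msupp p) p@_u *: ev 'X_[u].
    apply/rowP => a; rewrite summxE mxE mevalE; apply: eq_bigr => u _.
    by rewrite !mxE mevalX.
  rewrite big_seq; apply: summx_sub => u up; apply: scalemx_sub.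
  have uN : (mdeg u <= N)%N by rewrite -ltnS (leq_trans (msize_mdeg_lt up)).
  have [/forallP red|/forallPn[i]] := boolP [forall i, u i < e]%N.
    pose w : {ffun 'I_k -> 'I_e} := [ffun i => Ordinal (red i)].
    have -> : ev 'X_[u] = row (enum_rank w) V; last exact: row_sub.
    apply/rowP => a; rewrite !mxE enum_rankK mevalX.
    by apply: eq_bigr => i _; rewrite ffunE.
  rewrite -leqNgt => eu.
  have Uu : (U_(i) *+ e <= u)%MM.
    apply/mnm_lepP => j; rewrite mulmnE mnm1E.
    by have [<-|_] := eqVneq i j; rewrite ?mul1n ?mul0n.
  (* Replacing [X_i ^ e] by [g i] keeps the values at the points and lowers the degree, since [g i]
     has degree below [e]. *)
  have -> : ev 'X_[u] = ev ('X_[u - U_(i) *+ e] * g i).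
    apply/rowP => a; rewrite !mxE mevalM -yg -{1}(submK Uu) mpolyXD mevalM.
    by rewrite -mpolyXn rmorphXn /= mevalXU.
  apply: IHN; have [->|g0] := eqVneq (g i) 0; first by rewrite mulr0 msize0.
  rewrite msizeM // ?msizeX /=; last by rewrite -msize_poly_eq0 msizeX.
  have := congr1 mdeg (submK Uu); rewrite mdegD mdegMn mdeg1 mul1n => du.
  by apply: leq_trans uN; rewrite -du leq_add2l.
have full : row_full V.
  rewrite -sub1mx; apply/row_subP => a; rewrite row1.
  (* Lagrange interpolation: [l b] separates [y b] from [y a] by a coordinate where they differ, and
     the factor for [b = a] is 1. *)
  have /fin_all_exists[l lP] : forall b, exists l : {mpoly F[k]},
      l.@[y a] != 0 /\ (b != a -> l.@[y b] = 0).
    move=> b; have [->|ba] := eqVneq b a.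
      by exists 1; rewrite meval1 oner_eq0.
    have [/forallP eqy|/forallPn[i yi]] := boolP [forall i, y a i == y b i].
      have /y_inj ab : y a = y b by apply/ffunP => i; apply/eqP.
      by rewrite ab eqxx in ba.
    exists ('X_i - (y b i)%:MP); rewrite !mevalB !mevalC !mevalXU subr_eq0 subrr.
    by [].
  pose p := \prod_b l b.
  have pa : p.@[y a] != 0.
    by rewrite rmorph_prod; apply/prodf_neq0 => b _; case: (lP b).
  have -> : delta_mx 0 a = p.@[y a]^-1 *: ev p.
    apply/rowP => b; rewrite !mxE eqxx /=.
    have [->|ba] := eqVneq b a; first by rewrite mulVf.
    have -> : p.@[y b] = 0 by rewrite /p (bigD1 b) //= mevalM (lP b).2 // mul0r.
    by rewrite mulr0.
  exact/scalemx_sub/evV.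
have <- : \rank V = m by apply/eqP.
by apply: leq_trans (rank_leq_row V) _; rewrite card_ffun !card_ord.
Qed.

(** * Degree bounds; [msize] is the degree plus one, and 0 for the zero polynomial *)

Section Degrees.

Variables (R : idomainType) (k : nat).
Implicit Types p q : {mpoly R[k]}.

Lemma msize_mul_degree p q c d :
  (msize p <= c.+1)%N -> (msize q <= d.+1)%N -> (msize (p * q) <= (c + d).+1)%N.
Proof.
move=> pc qd; have [->|p0] := eqVneq p 0; first by rewrite mul0r msize0.
have [->|q0] := eqVneq q 0; first by rewrite mulr0 msize0.
by rewrite msizeM //; lia.
Qed.

Lemma msize_prod_degree (J : finType) (f : J -> {mpoly R[k]}) d :
  (forall j, (msize (f j) <= d.+1)%N) ->
  (msize (\prod_j f j) <= (#|J| * d).+1)%N.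
Proof.
move=> fd; rewrite cardE -big_enum /=.
elim: (enum J) => [|j s IHs]; first by rewrite big_nil msize1.
by rewrite big_cons mulSn; apply: msize_mul_degree.
Qed.

Lemma msize_sum_le (I : Type) (r : seq I) (P : pred I) (f : I -> {mpoly R[k]}) d :
  (forall i, P i -> (msize (f i) <= d)%N) ->
  (msize (\sum_(i <- r | P i) f i) <= d)%N.
Proof.
move=> fd; elim/big_ind: _ => [|p q pd qd|//]; first by rewrite msize0.
by apply: leq_trans (msizeD_le _ _) _; rewrite geq_max pd.
Qed.

Lemma msize_mderiv i p : (msize p^`M(i) <= msize p)%N.
Proof.
rewrite {1}[p]mpolyE big_seq raddf_sum /=; apply: msize_sum_le => m mp.
rewrite mderivZ mderivX; do 2!apply: leq_trans (msizeZ_le _ _) _.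
rewrite msizeX; apply: leq_ltn_trans (msize_mdeg_lt mp).
exact: mdegB.
Qed.

End Degrees.

Lemma meval_mderiv_varX (R : comNzRingType) k (a : {ffun 'I_k -> R}) i j n :
  (('X_j ^+ n.+1)^`M(i)).@[a] = (j == i)%:R * n.+1%:R * a i ^+ n.
Proof.
rewrite mpolyXn mderivX mevalZ mulmnE mnm1E natrM -mulrA.
have [->|_] := eqVneq j i; last by rewrite !mul0r.
have -> : (U_(i) *+ n.+1 - U_(i) = U_(i) *+ n)%MM.
  by apply/mnmP => l; rewrite mnmBE !mulmnE mulnS addKn.
have <- : 'X_i ^+ n = 'X_[U_(i) *+ n] :> {mpoly R[k]} by rewrite mpolyXn.
by rewrite mulrA rmorphXn /= mevalXU.
Qed.

(** * A Warren-type bound on nowhere-zero sign patterns *)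

Section SignPatterns.

Variables (R : rcfType) (k : nat).
Implicit Types (G h : {mpoly R[k]}) (x a : {ffun 'I_k -> R}) (Hs : seq {mpoly R[k]}).

(** The penalty has no mixed monomials, so the gradient equations express each pure power
    [X_i ^ n.-1] through a partial derivative of [G]. *)
Definition penalized G (eps : R) n : {mpoly R[k]} :=
  G - eps%:MP * \sum_(i < k) 'X_i ^+ n.

Lemma meval_penalized G eps n x :
  (penalized G eps n).@[x] = G.@[x] - eps * \sum_(i < k) x i ^+ n.
Proof.
rewrite mevalB mevalM mevalC rmorph_sum; congr (_ - _ * _).
by apply: eq_bigr => i _; rewrite rmorphXn /= mevalXU.
Qed.

Lemma meval_mderiv_penalized G eps n a i :
  ((penalized G eps n.+1)^`M(i)).@[a] =
  (G^`M(i)).@[a] - eps * n.+1%:R * a i ^+ n.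
Proof.
rewrite mderivB mderiv_mulC mevalB mevalM mevalC.
have -> : (\sum_(j < k) ('X_j : {mpoly R[k]}) ^+ n.+1)^`M(i) =
    \sum_(j < k) ('X_j ^+ n.+1)^`M(i) by exact: raddf_sum.
have -> : (\sum_(j < k) ('X_j ^+ n.+1)^`M(i)).@[a] =
    \sum_(j < k) (('X_j ^+ n.+1)^`M(i)).@[a] by exact: raddf_sum.
rewrite (bigD1 i) //= meval_mderiv_varX eqxx mul1r big1 ?addr0 ?mulrA // => j ji.
by rewrite meval_mderiv_varX (negPf ji) !mul0r.
Qed.

Lemma even_power_sum_ge0 n x : ~~ odd n -> 0 <= \sum_(i < k) x i ^+ n.
Proof. by move=> ne; apply: sumr_ge0 => i _; apply: exprn_even_ge0. Qed.

(** If the largest coordinate has absolute value [N >= 1], nonnegativity gives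
    [eps * N ^ (2D+2) <= G(x) <= C * N ^ (2D)], hence [eps * N ^ 2 <= C], which fails once
    [N > 1 + C / eps]. *)
Lemma penalized_nonneg_bounded G (eps : R) D :
  (msize G <= D.*2.+1)%N -> 0 < eps ->
  exists B : R, forall x, 0 <= (penalized G eps D.*2.+2).@[x] ->
    forall i, `|x i| <= B.
Proof.
move=> GD eps0; have [C C0 growth] := meval_growth GD.
exists (1 + C / eps) => x pos i0; rewrite leNgt; apply/negP => big0.
case: (@Order.TotalTheory.arg_maxP _ _ _ i0 xpredT (fun i => `|x i|) isT) => i _ imax.
set N := `|x i| in imax *.
have Ceps : 0 <= C / eps by apply: divr_ge0 => //; apply: ltW.
have NB : 1 + C / eps < N by apply: lt_le_trans big0 (imax _ _).
have N1 : 1 <= N by lra.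
have := growth x N N1 (fun j => imax j isT).
move: pos; rewrite meval_penalized subr_ge0 => low up.
have : eps * N ^+ D.*2.+2 <= C * N ^+ D.*2.
  apply: le_trans (le_trans low (le_trans (ler_norm _) up)).
  rewrite ler_wpM2l ?(ltW eps0) // (bigD1 i) //=.
  rewrite -normrX ger0_norm; last by apply: exprn_even_ge0; rewrite /= odd_double.
  rewrite lerDl; apply: sumr_ge0 => j _; apply: exprn_even_ge0.
  by rewrite /= odd_double.
rewrite -addn2 exprD [N ^+ _ * _]mulrC mulrA ler_pM2r; last first.
  by apply: exprn_gt0; lra.
have : C < eps * N.
  have CN : C / eps < N by lra.
  by rewrite -(divfK (lt0r_neq0 eps0) C) mulrC ltr_pM2l.
by rewrite expr2; nra.
Qed.

Lemma positive_locus_open Hs a : (forall h, h \in Hs -> 0 < h.@[a]) ->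
  exists2 d : R, 0 < d &
    forall x, (forall i, `|x i - a i| <= d) -> nonneg_locus Hs x.
Proof.
elim: Hs => [|h Hs IHs] pos; first by exists 1.
have [|d d0 dP] := IHs; first by move=> g gs; apply: pos; rewrite inE gs orbT.
have h0 : 0 < h.@[a] by apply: pos; rewrite mem_head.
have [d' d'0 d'P] := meval_continuous h a h0.
exists (Num.min d d') => [|x xa g]; first by rewrite lt_min d0.
rewrite inE => /orP[/eqP->|gs].
  have : `|h.@[x] - h.@[a]| < h.@[a].
    by apply: d'P => i; apply: le_trans (xa i) _; rewrite ge_min lexx orbT.
  by rewrite ltr_norml => /andP[+ _]; lra.
by apply: (dP x) => // i; apply: le_trans (xa i) _; rewrite ge_min lexx.
Qed.

(* The penalized polynomial is positive at x0 and tends to minus infinity, so it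
   attains its maximum over the region, and it does so away from the boundary,
   where G is nonpositive. *)
Lemma critical_point_in_region Hs G (eps : R) D x0 :
  (msize G <= D.*2.+1)%N -> 0 < eps -> nonneg_locus Hs x0 ->
  0 < (penalized G eps D.*2.+2).@[x0] ->
  (forall x, 0 < G.@[x] -> forall h, h \in Hs -> h.@[x] != 0) ->
  exists a, (forall h, h \in Hs -> 0 < h.@[a]) /\
    forall i, (G^`M(i)).@[a] = eps * D.*2.+2%:R * a i ^+ D.*2.+1.
Proof.
move=> GD eps0 Hx0 pos0 bnd; set P := penalized G eps _ in pos0 *.
have [B PB] := penalized_nonneg_bounded GD eps0.
(* Adding [P] to the constraints makes the locus bounded. *)
have PHx0 : nonneg_locus (P :: Hs) x0.
  by move=> h; rewrite inE => /orP[/eqP->|]; [apply: ltW | apply: Hx0].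
have [|a [Ha amax]] := mpoly_extreme_value P (B := B) PHx0.
  by move=> x Hx; apply: PB; apply: Hx; rewrite mem_head.
have Pa : 0 < P.@[a] by apply: lt_le_trans pos0 (amax _ PHx0).
have Ga : 0 < G.@[a].
  move: Pa; rewrite meval_penalized subr_gt0; apply: le_lt_trans.
  apply: mulr_ge0; first exact: ltW.
  by apply: even_power_sum_ge0; rewrite /= odd_double.
have posHs h : h \in Hs -> 0 < h.@[a].
  move=> hs; rewrite lt_neqAle eq_sym (bnd a Ga h hs) /=.
  by apply: Ha; rewrite inE hs orbT.
exists a; split=> // i.
(* All constraints are strict at [a], so a short segment along axis [i] stays in the locus. *)
have [|d d0 dP] := @positive_locus_open (P :: Hs) a.
  by move=> h; rewrite inE => /orP[/eqP->//|/posHs].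
have /eqP := meval_mderiv_penalized G eps D.*2.+1 a i.
rewrite -/P -deriv_line_poly (@deriv_local_max _ _ d d0).
  by rewrite eq_sym subr_eq0 => /eqP.
move=> t td; rewrite !horner_line_poly.
have -> : P.@[[ffun j => a j + (j == i)%:R * 0]] = P.@[a].
  by apply: meval_eq => j; rewrite ffunE mulr0 addr0.
apply: amax; apply: dP => j; rewrite ffunE addrC addKr.
by case: eqP => _; rewrite ?mul1r ?mul0r ?normr0 ?ltW.
Qed.

(** One [eps] serves all patterns; each yields a critical point in its own region, and all these
    points solve the same system with exponent [2D+1]. *)
Theorem sign_patterns_bound (J : finType) (f : J -> {mpoly R[k]}) d
    (S : {set {ffun J -> bool}}) :
  (forall j, (msize (f j) <= d.+1)%N) ->
  (forall s, s \in S -> exists x : {ffun 'I_k -> R},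
      forall j, (f j).@[x] != 0 /\ s j = ((f j).@[x] < 0)) ->
  (#|S| <= (#|J| * d).*2.+1 ^ k)%N.
Proof.
move=> fd real; set D := (#|J| * d)%N.
have /fin_all_exists[x xP] : forall s, exists x : {ffun 'I_k -> R},
    s \in S -> forall j, (f j).@[x] != 0 /\ s j = ((f j).@[x] < 0).
  move=> s; have [/real[x xs]|_] := boolP (s \in S); last by exists [ffun=> 0].
  by exists x.
pose F := \prod_j f j; pose G := F * F.
have FE z : F.@[z] = \prod_j (f j).@[z] by rewrite rmorph_prod.
have GD : (msize G <= D.*2.+1)%N.
  by rewrite -addnn; apply: msize_mul_degree; apply: msize_prod_degree.
have Gpos z : (0 < G.@[z]) = [forall j, (f j).@[z] != 0].
  rewrite mevalM -expr2 lt_neqAle sqr_ge0 andbT eq_sym sqrf_eq0 FE.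
  apply/idP/forallP => [nz j|nz]; last exact/prodf_neq0.
  by move/prodf_neq0: nz => /(_ j); apply.
(* The penalized polynomial is positive at [x s] exactly when [eps * w s < 1]; [W] below exceeds
   every [w s]. *)
pose w s := (\sum_(i < k) x s i ^+ D.*2.+2) / G.@[x s].
have w0 s : s \in S -> 0 <= w s.
  move=> /xP sx; apply: divr_ge0.
    by apply: even_power_sum_ge0; rewrite /= odd_double.
  by apply: ltW; rewrite Gpos; apply/forallP => j; case: (sx j).
pose W := 1 + \sum_(s in S) w s.
have W0 : 0 < W by apply: ltr_pwDl => //; apply: sumr_ge0.
pose eps := W^-1.
have eps0 : 0 < eps by rewrite invr_gt0.
have /fin_all_exists[y yP] : forall s, exists y : {ffun 'I_k -> R}, s \in S ->
    (forall j, (f j).@[y] != 0 /\ s j = ((f j).@[y] < 0)) /\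
    forall i, (G^`M(i)).@[y] = eps * D.*2.+2%:R * y i ^+ D.*2.+1.
  move=> s; have [sS|_] := boolP (s \in S); last by exists [ffun=> 0].
  have sx := xP s sS.
  have Gx : 0 < G.@[x s] by rewrite Gpos; apply/forallP => j; case: (sx j).
  (* Twisting each [f j] by its prescribed sign turns the sign region into a positivity region. *)
  pose Hs := [seq (-1) ^+ s j *: f j | j <- enum J].
  have HsE z : (forall h, h \in Hs -> 0 < h.@[z]) ->
      forall j, (f j).@[z] != 0 /\ s j = ((f j).@[z] < 0).
    move=> Hz j; have /Hz : (-1) ^+ s j *: f j \in Hs.
      by apply/mapP; exists j; rewrite ?mem_enum.
    rewrite mevalZ; case: (s j); rewrite ?expr0 ?expr1 ?mul1r ?mulN1r.
      by rewrite oppr_gt0 => fz; rewrite fz lt_eqF.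
    by move=> fz; rewrite gt_eqF // ltNge ltW.
  have [|||y [Hy ycrit]] := @critical_point_in_region Hs G eps D (x s) GD eps0.
  - move=> h /mapP[j _ ->]; have [_ sj] := sx j; rewrite mevalZ sj.
    by have [f0|f0] := ltrP; rewrite ?expr0 ?expr1 ?mul1r ?mulN1r ?oppr_ge0 // ltW.
  - rewrite meval_penalized subr_gt0 mulrC ltr_pdivrMr //.
    have -> : \sum_(i < k) x s i ^+ D.*2.+2 = w s * G.@[x s].
      by rewrite divfK // gt_eqF.
    rewrite mulrC ltr_pM2l // /W (bigD1 s) //=.
    by rewrite addrCA ltr_pwDr // ltr_pwDl // sumr_ge0 // => t /andP[/w0].
  - move=> z; rewrite Gpos => /forallP nz h /mapP[j _ ->].
    by rewrite mevalZ mulf_neq0 ?signr_eq0.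
  by exists y => _; split=> //; apply: HsE.
pose c := eps * D.*2.+2%:R.
have c0 : c != 0 by rewrite mulf_neq0 ?pnatr_eq0 // gt_eqF.
apply: (@card_triangular_solutions R k _ #|S| (fun b => y (enum_val b))
          (fun i => c^-1 *: G^`M(i))).
(* The signs of the [f j] at a critical point recover its pattern. *)
- move=> b b' yb; apply: enum_val_inj; apply/ffunP => j.
  have [/(_ j)[_ ->] _] := yP _ (enum_valP b).
  by have [/(_ j)[_ ->] _] := yP _ (enum_valP b'); rewrite yb.
- move=> i; apply: leq_trans (msizeZ_le _ _) _.
  exact: leq_trans (msize_mderiv _ _) GD.
- move=> b i; rewrite mevalZ; have [_ ->] := yP _ (enum_valP b).
  by rewrite mulKf.
Qed.

End SignPatterns.

(** * The polynomials attached to a linear complementarity problem *)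

(** The unit columns of [A_B] force a left null vector to vanish off [B]; the other columns put its
    restriction to [B] in the left kernel of the principal submatrix on [B], which is
    nonsingular. *)
Lemma det_A_B_neq0 (R : realFieldType) n (M : 'M[R]_n) (B : {set 'I_n}) :
  is_Pmatrix M -> \det (A_B M B) != 0.
Proof.
move=> /(_ B) PM; apply/negP => /det0P[v v0 vA].
have vA0 j : \sum_i v 0 i * A_B M B i j = 0.
  by have := congr1 (fun w : 'rV_n => w 0 j) vA; rewrite !mxE.
have vC j : j \notin B -> v 0 j = 0.
  move=> jB; have := vA0 j; rewrite (bigD1 j) //= big1 => [|i ij].
    by rewrite mxE (negPf jB) eqxx mulr1 addr0.
  by rewrite mxE (negPf jB) (negPf ij) mulr0.
have vB j : j \in B -> \sum_(i in B) v 0 i * M i j = 0.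
  move=> jB; apply: oppr_inj; rewrite oppr0 -[RHS](vA0 j) (bigID (mem B) predT) /=.
  rewrite [X in _ = _ + X]big1 ?addr0 => [|i /vC->]; last by rewrite mul0r.
  by rewrite -sumrN; apply: eq_bigr => i _; rewrite mxE jB mulrN.
pose u : 'rV_#|B| := \row_i v 0 (enum_val i).
have u0 : u = 0.
  apply/eqP/negPn/negP => nu; move: PM; rewrite /principal_minor.
  have -> : \det (\matrix_(i < #|B|, j < #|B|) M (enum_val i) (enum_val j)) = 0.
    apply/eqP/det0P; exists u => //; apply/rowP => j; rewrite !mxE.
    rewrite -[RHS](vB _ (enum_valP j)) [RHS]big_enum_val.
    by apply: eq_bigr => i _; rewrite !mxE.
  by rewrite ltxx.
case/eqP: v0; apply/rowP => j; rewrite [RHS]mxE.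
have [jB|/vC//] := boolP (j \in B).
have := congr1 (fun w : 'rV_#|B| => w 0 (enum_rank_in jB j)) u0.
by rewrite !mxE enum_rankK_in.
Qed.

Lemma msize_det (R : idomainType) k n (A : 'M[{mpoly R[k]}]_n) :
  (forall i j, (msize (A i j) <= 2)%N) -> (msize (\det A) <= n.+1)%N.
Proof.
move=> A1; apply: msize_sum_le => s _; rewrite -[n in n.+1]add0n.
apply: msize_mul_degree; first by rewrite -signr_odd; case: odd; rewrite ?msizeN msize1.
rewrite -[n in n.+1]muln1 -[n in (n * _)%N]card_ord.
exact: msize_prod_degree.
Qed.

Lemma msize_adj (R : idomainType) k n (A : 'M[{mpoly R[k]}]_n) i j :
  (forall i j, (msize (A i j) <= 2)%N) -> (msize ((\adj A) i j) <= n.-1.+1)%N.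
Proof.
move=> A1; rewrite mxE -[n.-1]add0n; apply: msize_mul_degree.
  by rewrite -signr_odd; case: odd; rewrite ?msizeN msize1.
by apply: msize_det => a b; rewrite !mxE.
Qed.

Section LCPPolynomials.

Variables (R : rcfType) (n : nat).

Definition lcp_var : finType := ('I_n * 'I_n + 'I_n)%type.

Local Notation mpolyLCP := {mpoly R[#|lcp_var|]}.

Definition generic_M : 'M[mpolyLCP]_n :=
  \matrix_(i, j) 'X_(enum_rank (inl (i, j) : lcp_var)).

Definition generic_q : 'cV[mpolyLCP]_n :=
  \col_i 'X_(enum_rank (inr i : lcp_var)).

(** Where [A] is invertible this equals [(\det A) ^ 2] times the entry of the solution, so it has
    the right sign whatever the sign of [\det A]. *)
Definition lcp_poly (vi : cube n * 'I_n) : mpolyLCP :=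
  let A := A_B generic_M (Bset vi.1) in
  \det A * (\adj A *m generic_q) vi.2 0.

Definition lcp_point (M : 'M[R]_n) (q : 'cV[R]_n) : {ffun 'I_#|lcp_var| -> R} :=
  [ffun t => match enum_val t : lcp_var with
             | inl (i, j) => M i j
             | inr i => q i 0
             end].

Lemma meval_lcp_poly M q (vi : cube n * 'I_n) :
  (lcp_poly vi).@[lcp_point M q] =
  \det (A_B M (Bset vi.1)) * (\adj (A_B M (Bset vi.1)) *m q) vi.2 0.
Proof.
pose ev : {rmorphism mpolyLCP -> R} := meval (lcp_point M q).
have evX t : ev 'X_(enum_rank t) = match t with
    | inl (i, j) => M i j | inr i => q i 0 end.
  by rewrite [LHS]mevalXU ffunE enum_rankK.
have evA B : map_mx ev (A_B generic_M B) = A_B M B.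
  apply/matrixP => i j; rewrite !mxE; case: ifP => _; last by rewrite rmorph_nat.
  by rewrite rmorphN evX.
have evq : map_mx ev generic_q = q by apply/colP => i; rewrite !mxE evX.
rewrite /lcp_poly [LHS](rmorphM ev) -det_map_mx evA; congr (_ * _).
by rewrite -evq -evA -map_mx_adj -map_mxM [RHS]mxE.
Qed.

Lemma lcp_poly_sign M q (vi : cube n * 'I_n) : is_Pmatrix M ->
  exists2 c : R, 0 < c &
    (lcp_poly vi).@[lcp_point M q] = c * (invmx (A_B M (Bset vi.1)) *m q) vi.2 0.
Proof.
move=> PM; set A := A_B M _.
have dA : \det A != 0 by apply: det_A_B_neq0.
exists (\det A ^+ 2); first by rewrite lt_neqAle sqr_ge0 eq_sym sqrf_eq0 dA.
rewrite meval_lcp_poly -/A /invmx unitmxE unitfE dA -scalemxAl [X in _ = _ * X]mxE.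
by rewrite mulrA expr2 mulfK.
Qed.

Lemma msize_lcp_poly vi : (msize (lcp_poly vi) <= n.*2.+1)%N.
Proof.
have A1 i j : (msize (A_B generic_M (Bset vi.1) i j) <= 2)%N.
  rewrite mxE; case: ifP => _; first by rewrite mxE msizeN msizeX mdeg1.
  by case: eqP => _; rewrite ?msize1 ?msize0.
rewrite -addnn; apply: msize_mul_degree; first exact: msize_det.
rewrite mxE; apply: msize_sum_le => j _.
(* The index [j] witnesses that [n] is positive; the degree is [n.-1] from the adjugate plus 1 from
   [generic_q]. *)
have n1 : (n = n.-1 + 1)%N by have := ltn_ord j; lia.
rewrite [X in (_ <= X.+1)%N]n1; apply: msize_mul_degree; last by rewrite mxE msizeX mdeg1.
exact: msize_adj.
Qed.

End LCPPolynomials.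

(** * The numerical estimate and the conclusion *)

(** There are [2 ^ n * n] polynomials of degree at most [2n] in [n * n + n] variables. The base is
    at most [2 ^ (6n)] because [n <= 2 ^ n], and the exponent is at most [2 * n ^ 2], whence the
    constant 12. *)
Lemma sign_pattern_exponent_bound n : (0 < n)%N ->
  (((2 ^ n * n) * n.*2).*2.+1 ^ (n * n + n) <= 2 ^ (12 * n ^ 3))%N.
Proof.
move=> n0; have n2 : (n <= 2 ^ n)%N by rewrite ltnW // ltn_expl.
have base : (((2 ^ n * n) * n.*2).*2.+1 <= 2 ^ (6 * n))%N.
  apply: leq_trans (_ : 2 ^ (3 * n + 3) <= _)%N; last by rewrite leq_pexp2l //; lia.
  have -> : (3 * n + 3 = n + n + n + 3)%N by lia.
  rewrite !expnD -[(2 ^ 3)%N]/8%N; set t := (2 ^ n)%N in n2 *.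
  have : (t * n * n <= t * t * t)%N by rewrite -!mulnA leq_mul // leq_mul.
  have : (0 < t * t * t)%N by rewrite !muln_gt0 expn_gt0.
  by rewrite -!mul2n; nia.
apply: leq_trans (_ : (2 ^ (6 * n)) ^ (n * n + n) <= _)%N.
  by rewrite leq_exp2r // addn_gt0 n0 orbT.
by rewrite -expnM leq_pexp2l // !expnS expn0; nia.
Qed.

Theorem mainTheorem2 (R : rcfType) :
  exists c : nat, (0 < c)%N /\
    forall (n : nat), (1 <= n)%N ->
    forall S : {set orientation n},
      (forall o, o \in S -> is_PUSO R o) ->
      (#|S| <= 2 ^ (c * n ^ 3))%N.
Proof.
exists 12%N; split=> // n n0 S SP.
apply: leq_trans (sign_pattern_exponent_bound n0).
have -> : (n * n + n)%N = #|lcp_var n| by rewrite card_sum card_prod card_ord.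
have -> : (2 ^ n * n)%N = #|{: cube n * 'I_n}|.
  by rewrite card_prod card_ffun card_bool !card_ord.
(* An [orientation] is a boolean function of the pairs [(v, i)], hence is itself a sign pattern of
   the family [lcp_poly]. *)
apply: (sign_patterns_bound (@msize_lcp_poly R n)) => o /SP[_ [M [q [PM nd ind]]]].
exists (lcp_point M q) => -[v i].
have [c c0 ->] := lcp_poly_sign q (v, i) PM.
split; first by apply: mulf_neq0; [rewrite gt_eqF | apply: nd].
by rewrite pmulr_rlt0 //; apply: ind.
Qed.
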